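(* Let $0<q<1$. In $K_1(C(SU_q(2)))$ one has $[U]=[\widetilde w]$, where $$U=\begin{pmatrix}\alpha&-q\gamma^*\\ \gamma&\alpha^*\end{pmatrix}\in M_2(C(SU_q(2))),\qquad \widetilde w:=1+(\gamma-1)\big(1-\alpha^*(\alpha\alpha^* )^{-1}\alpha\big)\in C(SU_q(2)).$$
   Context: $C(SU_q(2))$ is the universal C*-algebra generated by $\alpha,\gamma$ with $\alpha\gamma=q\gamma\alpha$, $\alpha\gamma^*=q\gamma^*\alpha$, $\gamma\gamma^*=\gamma^*\gamma$, $\alpha^*\alpha+\gamma^*\gamma=1$, $\alpha\alpha^*+q^2\gamma\gamma^*=1$. Both $U$ and $\widetilde w$ are unitary ($\alpha\alpha^*$ is invertible). *)

(* Defs.v *)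
From HB Require Import structures.
From mathcomp Require Import all_boot all_order all_algebra.
From mathcomp Require Import all_classical all_reals all_analysis.
From mathcomp Require Import complex.

Set Implicit Arguments.
Unset Strict Implicit.
Unset Printing Implicit Defensive.

Import Order.TTheory GRing.Theory Num.Theory.
Import numFieldNormedType.Exports.

Local Open Scope classical_set_scope.
Local Open Scope ring_scope.
Local Open Scope complex_scope.

(* Unital normed *-algebras over the complex numbers R[i] satisfying the
   C*-identity.  The unitRingType part is no extra mathematical structure: it
   only provides x^-1 for the two-sided inverse of an invertible element.
   Following algType, 1 != 0 is part of the structure.  The norm is not the
   `|_| of normedZmodType, because the library has no join of that structure
   with rings other than numDomainType. *)
HB.mixin Record isPreCStarAlgebra (R : realType) A
    of GRing.UnitAlgebra R[i] A := {
  star : A -> A;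
  starD : forall x y : A, star (x + y) = star x + star y;
  starZ : forall (a : R[i]) (x : A), star (a *: x) = a^*%C *: star x;
  starM : forall x y : A, star (x * y) = star y * star x;
  starK : forall x : A, star (star x) = x;
  cnorm : A -> R;
  cnormD : forall x y : A, cnorm (x + y) <= cnorm x + cnorm y;
  cnormZ : forall (a : R[i]) (x : A),
    (cnorm (a *: x))%:C = `|a| * (cnorm x)%:C;
  cnorm0_eq0 : forall x : A, cnorm x = 0 -> x = 0;
  cnormM : forall x y : A, cnorm (x * y) <= cnorm x * cnorm y;
  cnorm_star : forall x : A, cnorm (star x * x) = cnorm x ^+ 2
}.

#[short(type="preCStarAlgType")]
HB.structure Definition PreCStarAlgebra (R : realType) :=
  {A of isPreCStarAlgebra R A & GRing.UnitAlgebra R[i] A}.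

(* Alias of A carrying the complex normed-space structure given by cnorm. *)
Definition normed_space (R : realType) (A : preCStarAlgType R) : Type := A.

Section NormedSpace.
Context {R : realType} (A : preCStarAlgType R).
Notation V := (normed_space A).

HB.instance Definition _ := GRing.Lmodule.copy V A.

Let nrm (x : V) : R[i] := (cnorm (x : A))%:C.

Let nrmD x y : nrm (x + y) <= nrm x + nrm y.
Proof. by rewrite /nrm -rmorphD lecR; exact: cnormD. Qed.

Let nrmZ (a : R[i]) (x : V) : nrm (a *: x) = `|a| * nrm x.
Proof. exact: cnormZ. Qed.

Let nrm0_eq0 x : nrm x = 0 -> x = 0.
Proof. by case=> /cnorm0_eq0. Qed.

HB.instance Definition _ := Lmodule_isNormed.Build R[i] V nrmD nrmZ nrm0_eq0.

End NormedSpace.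

HB.mixin Record PreCStarAlgebra_isComplete (R : realType) A
    of PreCStarAlgebra R A := {
  cnorm_complete : forall F : set_system (normed_space A),
    ProperFilter F -> cauchy F -> cvg F
}.

#[short(type="cstarAlgType")]
HB.structure Definition CStarAlgebra (R : realType) :=
  {A of PreCStarAlgebra_isComplete R A & PreCStarAlgebra R A}.

Reserved Notation "x ^#*" (at level 1, left associativity, format "x ^#*").
Notation "x ^#*" := (star x) : ring_scope.

Definition star_preserving (R : realType) (A B : cstarAlgType R)
  (f : A -> B) := forall x : A, f (x^#*) = (f x)^#*.

Record SUq2_relations (R : realType) (q : R) (A : cstarAlgType R)
    (alpha gamma : A) : Prop := SUq2Relations {
  SUq2_ag : alpha * gamma = q%:C *: (gamma * alpha);
  SUq2_ags : alpha * gamma^#* = q%:C *: (gamma^#* * alpha);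
  SUq2_gg : gamma * gamma^#* = gamma^#* * gamma;
  SUq2_sphere : alpha^#* * alpha + gamma^#* * gamma = 1;
  SUq2_sphere_q : alpha * alpha^#* + (q ^+ 2)%:C *: (gamma * gamma^#*) = 1
}.

(* (A, alpha, gamma) is the universal unital C*-algebra on the above relations,
   i.e. it is C(SU_q(2)) with its standard generators. *)
Record is_CSUq2 (R : realType) (q : R) (A : cstarAlgType R)
    (alpha gamma : A) : Prop := IsCSUq2 {
  CSUq2_rel : SUq2_relations q alpha gamma;
  CSUq2_lift : forall (B : cstarAlgType R) (a c : B), SUq2_relations q a c ->
    exists f : {lrmorphism A -> B},
      [/\ star_preserving f, f alpha = a & f gamma = c];
  CSUq2_uniq : forall (B : cstarAlgType R) (f g : {lrmorphism A -> B}),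
    star_preserving f -> star_preserving g ->
    f alpha = g alpha -> f gamma = g gamma -> f =1 g
}.

Section K1.
Context {R : realType} {A : cstarAlgType R}.

Definition starmx m n (u : 'M[A]_(m, n)) : 'M[A]_(n, m) := map_mx star u^T.

Definition unitary n (u : 'M[A]_n) : Prop :=
  starmx u *m u = 1%:M /\ u *m starmx u = 1%:M.

(* 'M[A]_n carries the topology of entrywise convergence, which is the topology
   of the C*-norm of M_n(A). *)
Definition unitary_homotopic n (u v : 'M[A]_n) : Prop :=
  exists h : R -> 'M[normed_space A]_n,
    [/\ {within `[0, 1], continuous h},
        forall t, t \in `[0, 1] -> unitary (h t), h 0 = u & h 1 = v].

Definition stab n k (u : 'M[A]_n) : 'M[A]_(n + k) := block_mx u 0 0 1%:M.

End K1.

(* The disjoint union of the unitary groups U_n(A), n >= 1. *)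
Record unitaries (R : realType) (A : cstarAlgType R) := Unitaries {
  usize : nat;
  umx : 'M[A]_usize.+1;
  umx_unitary : unitary umx
}.

Definition stably_homotopic (R : realType) (A : cstarAlgType R)
    (u v : unitaries A) : Prop :=
  exists (k l : nat) (e : ((usize u).+1 + k = (usize v).+1 + l)%N),
    unitary_homotopic (castmx (e, e) (stab k (umx u))) (stab l (umx v)).

(* The underlying set of the group K_1(A), with the class map u |-> [u]. *)
Definition K1 (R : realType) (A : cstarAlgType R) : Type :=
  {c : set (unitaries A) | exists u, c = [set v | stably_homotopic u v]}.

Definition K1_class (R : realType) (A : cstarAlgType R) (u : unitaries A) :
    K1 A :=
  exist _ [set v | stably_homotopic u v] (ex_intro _ u erefl).

Section Elements.
Context {R : realType} (q : R) {A : cstarAlgType R} (alpha gamma : A).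

Definition Umx : 'M[A]_2 := \matrix_(i, j)
  if i == 0 then if j == 0 then alpha else - (q%:C *: gamma^#*)
  else if j == 0 then gamma else alpha^#*.

Definition wtilde : A :=
  1 + (gamma - 1) * (1 - alpha^#* * (alpha * alpha^#*)^-1 * alpha).

End Elements.

(* Main.v *)
(* Write x = gamma^* gamma = gamma gamma^*, p = 1 - alpha^* (alpha alpha^* )^-1 alpha
   and w = wtilde = 1 - p + p gamma; p is a projection that commutes with gamma and
   satisfies alpha p = 0 and p x = p.

   Norm bound.  With y_n = alpha^*^n alpha^n the relations give
   x y_n = q^(2n) (y_n - y_(n+1)), so |x^N y_n| <= C_n q^-N for every n: take
   C_n = |alpha|^(2n) for large n and descend to n = 0.  As x is self-adjoint,
   the C*-identity yields |x| <= 1/q, hence q |gamma| < 1, and Neumann series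
   invert alpha alpha^* = 1 - q^2 x and 1 + t^2 + t q (gamma + gamma^* )
   for t in [0, 1].

   Homotopy.  If Z is unitary and 1 + t^2 + t (Z + Z^* ) = (1 + t Z)(1 + t Z)^* is
   invertible for t in [0, 1], then t |-> (t + Z)(1 + t Z)^-1 is a path of
   unitaries from Z to 1.  Let J be the quarter turn.  Then
   U = J diag(w, 1) Z with
     Z = ( p + (1-p) gamma    alpha^*   )
         (     - alpha       q gamma^*  ),
   and both J + J^* = 0 and Z + Z^* are diagonal, so the invertibility reduces
   to that of two elements of the algebra.  Hence U is homotopic to diag(w, 1). *)
Require Import Defs.
From mathcomp Require Import all_boot all_order all_algebra.
From mathcomp Require Import all_classical all_reals all_analysis.
From mathcomp Require Import complex ring lra.

Set Implicit Arguments.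
Unset Strict Implicit.
Unset Printing Implicit Defensive.

Import Order.TTheory GRing.Theory Num.Theory.
Import numFieldNormedType.Exports.

Local Open Scope classical_set_scope.
Local Open Scope ring_scope.
Local Open Scope complex_scope.

(** * A growth estimate and the algebra of the Moebius transform *)

(** Meant for [u N n] = |x^N y_n|. For large n the factor q^(2n) lets the bound m^n pass through the
    recursion; smaller n follow by descent, where u_(N+1) <= u_N + C rho^N keeps growth of rate rho
    because rho > 1. *)
Lemma geometric_growth (R : realType) (q m rho : R) (u : nat -> nat -> R) :
  0 < q < 1 -> 1 < rho -> 0 <= m -> (forall n, u 0%N n <= m ^+ n) ->
  (forall N n, u N.+1 n <= q ^+ (2 * n) * (u N n + u N n.+1)) ->
  (forall N n, 0 <= u N n) ->
  exists C, forall N, u N 0%N <= C * rho ^+ N.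
Proof.
move=> /andP[q0 q1] rho1 m0 u0 uS up.
have q20 : 0 <= q ^+ 2 < 1 by rewrite sqr_ge0 exprn_ilt1 ?ltW.
(* From [n0] on, the recursion maps the bound m^n to q^(2n) (1 + m) m^n <= m^n. *)
have [n0 hn0] : exists n0, forall n, (n0 <= n)%N -> q ^+ (2 * n) * (1 + m) <= 1.
  have /cvgrPdist_lt : (fun n => (q ^+ 2) ^+ n) @ \oo --> (0 : R).
    by apply: cvg_expr; case/andP: q20 => ? ?; rewrite ger0_norm.
  have m1 : 0 < 1 + m by rewrite ltr_pwDl.
  move=> /(_ (1 + m)^-1); rewrite invr_gt0 => /(_ m1)[n0 _ hn0].
  exists n0 => n /hn0/=; rewrite sub0r normrN -exprM => h.
  by rewrite -ler_pdivlMr// div1r ltW// (le_lt_trans (ler_norm _)).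
have rhoN N : 0 < rho ^+ N by rewrite exprn_gt0// (lt_trans ltr01).
have large N n : (n0 <= n)%N -> u N n <= m ^+ n.
  elim: N n => [|N IH] n n0n; first exact: u0.
  apply: (le_trans (uS _ _)).
  apply: (@le_trans _ _ (q ^+ (2 * n) * (m ^+ n + m ^+ n.+1))).
    rewrite ler_wpM2l ?exprn_ge0 ?(ltW q0)// lerD ?IH//.
    exact: leqW.
  rewrite exprS -{1}[m ^+ n]mul1r -mulrDl mulrA ler_piMl ?exprn_ge0//.
  exact: hn0.
suff : forall k n, (n0 <= n + k)%N -> exists C, forall N, u N n <= C * rho ^+ N.
  by move=> /(_ n0 0%N); exact.
elim=> [|k IH] n nk.
  exists (m ^+ n) => N; rewrite addn0 in nk.
  by rewrite (le_trans (large N n nk))// ler_peMr ?exprn_ge0// exprn_ege1 ?ltW.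
have [|C uC] := IH n.+1; first by rewrite addSnnS.
have C0 : 0 <= C by have := le_trans (up _ _) (uC 0%N); rewrite mulr1.
have r10 : 0 < rho - 1 by rewrite subr_gt0.
(* The constant K must satisfy K + C <= K rho, that is K >= C / (rho - 1); the summand m^n covers N
   = 0. *)
exists (m ^+ n + C / (rho - 1)); elim=> [|N IHN].
  by rewrite mulr1 (le_trans (u0 _))// lerDl divr_ge0// ltW.
apply: (le_trans (uS _ _)).
apply: (@le_trans _ _ (u N n + u N n.+1)).
  by rewrite ler_piMl ?addr_ge0// exprn_ile1 ?ltW.
apply: (le_trans (lerD IHN (uC N))); rewrite -mulrDl exprS mulrA ler_pM2r//.
have -> : (m ^+ n + C / (rho - 1)) * rho =
    m ^+ n + C / (rho - 1) + (C + (rho - 1) * m ^+ n).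
  by field; rewrite lt0r_neq0.
by rewrite lerD2l lerDl mulr_ge0 ?exprn_ge0// ltW.
Qed.

(* For D = ((1 + c z) (1 + c z'))^-1, the element (c *+ 2 + z + c^2 z') D is
   the Moebius transform (c + z) (1 + c z)^-1. *)
Lemma moebius_inverse (S : pzRingType) (c z z' D : S) :
  GRing.comm c z -> GRing.comm c z' -> z * z' = 1 -> z' * z = 1 ->
  (1 + c ^+ 2 + c * (z + z')) * D = 1 -> D * (1 + c ^+ 2 + c * (z + z')) = 1 ->
  (c *+ 2 + z + c ^+ 2 * z') * D * (D * (c *+ 2 + z' + c ^+ 2 * z)) = 1 /\
  GRing.comm D (c *+ 2 + z' + c ^+ 2 * z).
Proof.
move=> cz cz' zz' z'z HD DH; set H := 1 + _ + _ in HD DH.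
pose N := 1 + c * z; pose N' := 1 + c * z'.
have NN' : N' * N = H.
  rewrite /N /N' mulrDl mul1r mulrDr mulr1 -[c * z' * _]mulrA (mulrA z') -cz'.
  rewrite -(mulrA c z' z) z'z mulr1 -expr2 /H mulrDr -!addrA; congr (1 + _).
  by rewrite addrA [LHS]addrC.
(* As z z' = 1, the two numerators factor through [N'] and [N], whose product H is what cancels
   D. *)
have EV : c *+ 2 + z + c ^+ 2 * z' = (c + z) * N'.
  rewrite /N' mulrDl !mulrDr !mulr1 (mulrA z) -cz -(mulrA c z) zz' mulr1.
  rewrite mulrA -expr2 mulr2n -!addrA; congr (_ + _).
  by rewrite [RHS]addrC -[RHS]addrA [RHS]addrCA.
have EV' : c *+ 2 + z' + c ^+ 2 * z = N * (c + z').
  rewrite /N mulrDl !mulrDr !mul1r -(mulrA c z z') zz' mulr1 -mulrA -cz mulrA.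
  rewrite -expr2 mulr2n -!addrA; congr (_ + _).
  by rewrite [RHS]addrA [RHS]addrC.
have DC a : GRing.comm a c -> GRing.comm a z -> GRing.comm a z' -> GRing.comm a D.
  move=> ac az az'.
  have aH : GRing.comm a H.
    by apply: commrD; [apply: commrD; [exact: commr1 | exact: commrX]
                      | apply: commrM => //; exact: commrD].
  by rewrite /GRing.comm -[a * D]mul1r -DH -(mulrA D H) (mulrA H) -aH -!mulrA HD mulr1.
have zz'C : GRing.comm z z' by rewrite /GRing.comm zz' z'z.
have cD : GRing.comm c D by apply: DC => //; exact: commr_refl.
have zD : GRing.comm z D by apply: DC => //; exact: commr_sym.
have ND : GRing.comm N D.
  by apply/commr_sym/commrD; [exact: commr1 | apply: commrM; exact: commr_sym].
have z'D : GRing.comm z' D by apply: DC => //; exact: commr_sym.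
split; last first.
  apply: commrD; last by apply: commrM; [apply: commrX|]; exact: commr_sym.
  by apply: commrD; [apply: commrMn|]; exact: commr_sym.
(* Moving N to the left of both copies of D forms N' N = H and cancels one of them; the other
   cancels against (c + z)(c + z') = H. *)
rewrite EV EV' -!mulrA (mulrA D N) -ND -mulrA (mulrA D N) -ND.
rewrite (mulrA N') (mulrA N') NN' !mulrA -(mulrA _ H) HD mulr1.
rewrite [(c + z) * D]mulrDl cD zD -mulrDr -mulrA -[RHS]DH.
congr (D * _); rewrite /H mulrDl !mulrDr zz' -cz -expr2 -!addrA [RHS]addrC -!addrA.
by congr (_ + _); rewrite [RHS]addrCA.
Qed.

(** * Norm estimates and Neumann series in a C*-algebra *)

Section CStarBasics.
Context {R : realType} {A : cstarAlgType R}.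
Implicit Types (x y : A) (r : R).

Lemma star0 : (0 : A)^#* = 0.
Proof. by apply: (addrI (0 : A)^#*); rewrite -starD !addr0. Qed.

Lemma starN x : (- x)^#* = - x^#*.
Proof. by apply: (addrI x^#*); rewrite -starD !subrr star0. Qed.

Lemma starB x y : (x - y)^#* = x^#* - y^#*.
Proof. by rewrite starD starN. Qed.

Lemma star1 : (1 : A)^#* = 1.
Proof. by have := starM (1 : A)^#* 1; rewrite mulr1 starK mulr1. Qed.

Lemma star_sum (I : Type) (s : seq I) (P : pred I) (F : I -> A) :
  (\sum_(i <- s | P i) F i)^#* = \sum_(i <- s | P i) (F i)^#*.
Proof. exact: (big_morph (@star R A) (@starD R A) star0). Qed.

Lemma starX x n : (x ^+ n)^#* = x^#* ^+ n.
Proof. by elim: n => [|n IH]; rewrite ?star1// exprS starM IH -exprSr. Qed.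

Lemma starZr r x : (r%:C *: x)^#* = r%:C *: x^#*.
Proof. by rewrite starZ conjc_real. Qed.

Lemma star_inv x : x \is a GRing.unit -> x^-1^#* = (x^#*)^-1.
Proof.
move=> ux.
have xV : x^#* * x^-1^#* = 1 by rewrite -starM mulVr// star1.
have Vx : x^-1^#* * x^#* = 1 by rewrite -starM mulrV// star1.
have ux' : x^#* \is a GRing.unit by apply/unitrP; exists x^-1^#*.
by apply: (mulrI ux'); rewrite xV mulrV.
Qed.

Lemma cnormZr r x : cnorm (r%:C *: x) = `|r| * cnorm x.
Proof. by apply: complexI; rewrite cnormZ normc_def/= expr0n addr0 sqrtr_sqr rmorphM. Qed.

Lemma cnorm0 : cnorm (0 : A) = 0.
Proof. by rewrite -(scale0r (0 : A)) -[0]/(0%:C) cnormZr normr0 mul0r. Qed.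

Lemma cnormN x : cnorm (- x) = cnorm x.
Proof. by rewrite -scaleN1r -(rmorphN1 (real_complex R)) cnormZr normrN1 mul1r. Qed.

Lemma cnorm_ge0 x : 0 <= cnorm x.
Proof.
have := cnormD x (- x); rewrite subrr cnorm0 cnormN -mulr2n.
by rewrite pmulrn_lge0.
Qed.

Lemma cnormB x y : cnorm (x - y) <= cnorm x + cnorm y.
Proof. by rewrite -(cnormN y) cnormD. Qed.

Lemma cnorm_distC x y : cnorm (x - y) = cnorm (y - x).
Proof. by rewrite -cnormN opprB. Qed.

Lemma cnorm1 : cnorm (1 : A) = 1.
Proof.
have := cnorm_star (1 : A); rewrite star1 mul1r expr2 => n1.
apply: (@mulfI _ (cnorm (1 : A))); last by rewrite mulr1.
by apply/eqP => /cnorm0_eq0/eqP; rewrite oner_eq0.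
Qed.

Lemma cnorm_eq0P x : (forall e : R, 0 < e -> cnorm x <= e) -> x = 0.
Proof.
move=> xe; apply: cnorm0_eq0; apply/eqP; rewrite eq_le cnorm_ge0 andbT.
by apply/ler_addgt0Pl => e /xe; rewrite addr0.
Qed.

(** The C*-identity gives |y|^2 = |y^* y| <= |y^*| |y|; apply it to x and to its adjoint. *)
Lemma cnorm_starE x : cnorm x^#* = cnorm x.
Proof.
have le y : cnorm y <= cnorm y^#*.
  have [->|y0] := eqVneq (cnorm y) 0; first exact: cnorm_ge0.
  have {}y0 : 0 < cnorm y by rewrite lt_def y0 cnorm_ge0.
  rewrite -(ler_pM2r y0); apply: (le_trans _ (cnormM _ _)).
  by rewrite cnorm_star expr2.
by apply/eqP; rewrite eq_le le -{2}(starK x) le.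
Qed.

Lemma cnormX x n : cnorm (x ^+ n) <= cnorm x ^+ n.
Proof.
elim: n => [|n IH]; first by rewrite cnorm1.
by rewrite exprS (le_trans (cnormM _ _))// exprS ler_wpM2l// cnorm_ge0.
Qed.

(** For self-adjoint y the C*-identity reads |y^2| = |y|^2; iterate it k times. *)
Lemma cnorm_selfadjoint_exp2 x k :
  x^#* = x -> cnorm (x ^+ (2 ^ k)) = cnorm x ^+ (2 ^ k).
Proof.
move=> sx; elim: k => [|k IH]; first by rewrite !expr1.
by rewrite expnSr exprM [RHS]exprM -IH -cnorm_star starX sx expr2.
Qed.

(** The norm of a self-adjoint element is its spectral radius, so the size of C does not matter: r <
    |x| would give (|x| / r)^(2^k) <= C for all k. *)
Lemma cnorm_selfadjoint_le x (C r : R) : 0 < r -> x^#* = x ->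
  (forall n, cnorm (x ^+ n) <= C * r ^+ n) -> cnorm x <= r.
Proof.
move=> r0 sx xC; rewrite leNgt; apply/negP => rx.
pose t := cnorm x / r.
have t1 : 1 < t by rewrite /t ltr_pdivlMr// mul1r.
have tC k : t ^+ (2 ^ k) <= C.
  by rewrite /t expr_div_n ler_pdivrMr ?exprn_gt0// -cnorm_selfadjoint_exp2// xC.
(* Bernoulli's inequality: the powers of t > 1 eventually exceed C. *)
have tn n : 1 + n%:R * (t - 1) <= t ^+ n.
  elim: n => [|n IH]; first by rewrite mul0r addr0.
  rewrite exprS; apply: (@le_trans _ _ (t * (1 + n%:R * (t - 1)))).
    rewrite -subr_ge0 -natr1 [leRHS](_ : _ = n%:R * (t - 1) ^+ 2); last by ring.
    by rewrite mulr_ge0 ?sqr_ge0.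
  by rewrite ler_pM2l// (lt_trans ltr01).
have [k kC] : exists k : nat, C < 1 + k%:R * (t - 1).
  exists (Num.truncn (`|C| / (t - 1))).+1.
  have t10 : 0 < t - 1 by rewrite subr_gt0.
  have : `|C| / (t - 1) < (Num.truncn (`|C| / (t - 1))).+1%:R by exact: truncnS_gt.
  rewrite ltr_pdivrMr// => h.
  by rewrite (le_lt_trans (ler_norm _))// (lt_trans h)// ltrDr.
have := le_trans (tn (2 ^ k)%N) (tC k).
rewrite leNgt => /negP; apply; apply: (lt_le_trans kC).
rewrite lerD2l; apply: ler_wpM2r; first by rewrite subr_ge0 ltW.
by rewrite ler_nat ltnW// ltn_expl.
Qed.

(** The norm of [normed_space A] takes values in [R[i]], where 0 < e forces e to be real, so real
    radii suffice. *)
Lemma cvg_cnormP (T : Type) (F : set_system T) (FF : Filter F)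
    (f : T -> normed_space A) (a : normed_space A) :
  f @ F --> a <-> forall e : R, 0 < e -> \forall t \near F, cnorm ((f t : A) - a) < e.
Proof.
split=> [/cvgrPdistC_lt fa e e0|fa].
  have := fa e%:C; rewrite ltcR => /(_ e0); apply: filterS => t.
  by rewrite /Num.norm/= ltcR.
apply/cvgrPdistC_lt => -[e e']; rewrite ltcE/= => /andP[/eqP-> e0].
by apply: filterS (fa _ e0) => t; rewrite /Num.norm/= ltcR.
Qed.

(** The partial sums of the geometric series are Cauchy because s_(n+k) - s_n = y^n s_k with s_k
    bounded; their limit is the inverse. *)
Lemma neumann_unit y : cnorm y < 1 -> 1 - y \is a GRing.unit.
Proof.
move=> y1; pose s n := \sum_(k < n) y ^+ k.
have y10 : 0 < 1 - cnorm y by rewrite subr_gt0.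
pose C := (1 - cnorm y)^-1.
have C0 : 0 < C by rewrite invr_gt0.
have sC n : cnorm (s n) <= C.
  rewrite /C -[leRHS]mul1r ler_pdivlMr//.
  have sle : cnorm (s n) <= \sum_(k < n) cnorm y ^+ k.
    rewrite /s; elim/big_ind2 : _ => [|a b c d ab cd|i _]; rewrite ?cnorm0//.
      by rewrite (le_trans (cnormD _ _))// lerD.
    exact: cnormX.
  apply: (@le_trans _ _ ((\sum_(k < n) cnorm y ^+ k) * (1 - cnorm y))).
    by rewrite ler_wpM2r// ltW.
  rewrite mulrC -[1 - cnorm y]opprB mulNr -subrX1 opprB.
  by rewrite gerBl exprn_ge0// cnorm_ge0.
have sD n k : s (n + k)%N - s n = y ^+ n * s k.
  rewrite /s big_split_ord/= addrAC subrr add0r mulr_sumr.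
  by apply: eq_bigr => i _; rewrite exprD.
have ys n : (1 - y) * s n = 1 - y ^+ n.
  by rewrite -[1 - y]opprB mulNr -subrX1 opprB.
have sy n : s n * (1 - y) = 1 - y ^+ n.
  rewrite -ys; apply/esym/commr_sum => i _; apply/commrX/commr_sym/commrB.
    exact: commr1.
  exact: commr_refl.
have yn0 (e : R) : 0 < e -> exists N, cnorm y ^+ N < e.
  move=> e0; have : (fun n => cnorm y ^+ n) @ \oo --> (0 : R).
    by apply: cvg_expr; rewrite ger0_norm// cnorm_ge0.
  move=> /cvgrPdist_lt/(_ _ e0)[N _ /(_ N (leqnn N))]; rewrite sub0r normrN.
  by exists N; rewrite (le_lt_trans (ler_norm _)).
have yle n k : (n <= k)%N -> cnorm y ^+ k <= cnorm y ^+ n.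
  by move=> nk; apply: ler_wiXn2l; rewrite ?cnorm_ge0// ltW.
have : cauchy ((s : nat -> normed_space A) @ \oo).
  apply: cauchy_exP => -[e e']; rewrite ltcE/= => /andP[/eqP-> e0].
  have [N Ne] := yn0 (e / C) (divr_gt0 e0 C0).
  exists (s N); exists N => // n /= Nn.
  rewrite -ball_normE /= /Num.norm/= ltcR cnorm_distC.
  rewrite -(subnKC Nn) sD (le_lt_trans (cnormM _ _))//.
  apply: (@le_lt_trans _ _ (cnorm y ^+ N * C)).
    by apply: ler_pM; rewrite ?cnorm_ge0 ?cnormX.
  by rewrite -ltr_pdivlMr.
move/cnorm_complete => /cvg_ex[/= b /cvg_cnormP sb].
(* Passage to the limit, used for z = [b * (1 - y) - 1] and z = [(1 - y) * b - 1]. The proof divides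
   by L + 1, which is positive even when L = 0. *)
have lim0 (z : A) (L : R) : 0 <= L ->
    (forall n, cnorm z <= L * cnorm (s n - b) + cnorm (y ^+ n)) -> z = 0.
  move=> L0 zle; apply: cnorm_eq0P => e e0.
  have e20 : 0 < e / 2 by rewrite divr_gt0.
  have L1 : 0 < L + 1 by rewrite ltr_wpDl.
  have [N1 _ N1e] := sb _ (divr_gt0 e20 L1).
  have [N2 N2e] := yn0 _ e20.
  pose n := maxn N1 N2; apply: (le_trans (zle n)).
  rewrite (splitr e) lerD//; last first.
    by rewrite (le_trans (cnormX _ _))// (le_trans (yle _ _ (leq_maxr N1 N2)))// ltW.
  apply: (@le_trans _ _ ((L + 1) * cnorm (s n - b))).
    by rewrite ler_wpM2r ?cnorm_ge0// lerDl.
  by rewrite -ler_pdivlMl// mulrC ltW// N1e//= leq_maxl.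
apply/unitrP; exists b; split; apply/eqP; rewrite -subr_eq0; apply/eqP.
- apply: (lim0 _ (cnorm (1 - y))) => [|n]; first exact: cnorm_ge0.
  have -> : b * (1 - y) - 1 = - ((s n - b) * (1 - y)) - y ^+ n.
    rewrite [(_ - b) * _]mulrBl sy opprB -addrA opprB.
    by rewrite addrAC subrr add0r.
  rewrite (le_trans (cnormB _ _))// lerD2r cnormN mulrC.
  exact: cnormM.
- apply: (lim0 _ (cnorm (1 - y))) => [|n]; first exact: cnorm_ge0.
  have -> : (1 - y) * b - 1 = - ((1 - y) * (s n - b)) - y ^+ n.
    rewrite [_ * (_ - b)]mulrBr ys opprB -addrA opprB.
    by rewrite addrAC subrr add0r.
  rewrite (le_trans (cnormB _ _))// lerD2r cnormN.
  exact: cnormM.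
Qed.

End CStarBasics.

(** * Continuous paths in the algebra *)

Section Paths.
Context {R : realType} {A : cstarAlgType R}.
Implicit Types (f g : R -> A).

(** Continuity on [0, 1] phrased with [cnorm] and real radii, so that estimates stay in A;
    [within_continuous_mxP] links it to the topology of matrices. *)
Definition path_continuous f := forall t : R, t \in `[0, 1] -> forall e : R, 0 < e ->
  \forall s \near within `[0, 1] (nbhs t), cnorm (f s - f t) < e.

Lemma path_cst (a : A) : path_continuous (fun=> a).
Proof. by move=> t _ e e0; near=> s; rewrite subrr cnorm0.
Unshelve. all: by end_near. Qed.

Lemma path_id : path_continuous (fun t => t%:C%:A).
Proof.
move=> t _ e e0; near=> s.
rewrite -scalerBl -rmorphB cnormZr cnorm1 mulr1 distrC.
by near: s; apply: cvg_within; exact: nbhsx_ballx.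
Unshelve. all: by end_near. Qed.

Lemma pathD f g : path_continuous f -> path_continuous g ->
  path_continuous (fun t => f t + g t).
Proof.
move=> fc gc t t01 e e0; near=> s.
rewrite opprD addrACA (le_lt_trans (cnormD _ _))// (splitr e) ltrD//.
  by near: s; apply: fc; rewrite // divr_gt0.
by near: s; apply: gc; rewrite // divr_gt0.
Unshelve. all: by end_near. Qed.

Lemma path_star f : path_continuous f -> path_continuous (fun t => (f t)^#*).
Proof.
move=> fc t t01 e e0; apply: filterS (fc t t01 e e0) => s.
by rewrite -starB cnorm_starE.
Qed.

Lemma pathM f g : path_continuous f -> path_continuous g ->
  path_continuous (fun t => f t * g t).
Proof.
move=> fc gc t t01 e e0.
(* The added 1 makes both bounds positive, and lets [a] dominate [cnorm (g s)] once g s is within 1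
   of g t. *)
pose a := cnorm (g t) + 1; pose b := cnorm (f t) + 1.
have a0 : 0 < a by rewrite ltr_wpDl// cnorm_ge0.
have b0 : 0 < b by rewrite ltr_wpDl// cnorm_ge0.
near=> s.
have fs : cnorm (f s - f t) < e / 2 / a.
  by near: s; apply: fc; rewrite // !divr_gt0.
have gs : cnorm (g s - g t) < e / 2 / b.
  by near: s; apply: gc; rewrite // !divr_gt0.
have gs1 : cnorm (g s - g t) < 1 by near: s; exact: gc.
have gsa : cnorm (g s) <= a.
  by rewrite -(subrK (g t) (g s)) (le_trans (cnormD _ _))// addrC lerD2l ltW.
have -> : f s * g s - f t * g t = (f s - f t) * g s + f t * (g s - g t).
  by rewrite mulrBl mulrBr addrA subrK.
rewrite (le_lt_trans (cnormD _ _))// (splitr e) ltr_leD//.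
  rewrite (le_lt_trans (cnormM _ _))// -(divfK (lt0r_neq0 a0) (e / 2)).
  apply: (@le_lt_trans _ _ (cnorm (f s - f t) * a)).
    by rewrite ler_wpM2l// cnorm_ge0.
  by rewrite ltr_pM2r.
rewrite (le_trans (cnormM _ _))// -(divfK (lt0r_neq0 b0) (e / 2)) [leRHS]mulrC.
by apply: ler_pM; rewrite ?cnorm_ge0 ?lerDl// ltW.
Unshelve. all: by end_near. Qed.

Lemma pathV f : path_continuous f ->
  (forall t : R, t \in `[0, 1] -> f t \is a GRing.unit) ->
  path_continuous (fun t => (f t)^-1).
Proof.
move=> fc fu t t01 e e0; pose a := cnorm (f t)^-1 + 1.
have a0 : 0 < a by rewrite ltr_wpDl// cnorm_ge0.
have ba : cnorm (f t)^-1 <= a by rewrite lerDl.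
near=> s.
have s01 : s \in `[0, 1] by near: s; apply: withinT.
have fs1 : cnorm (f s - f t) < (2 * a)^-1.
  by near: s; apply: fc; rewrite // invr_gt0 mulr_gt0.
have fs2 : cnorm (f s - f t) < e / (2 * a * a).
  by near: s; apply: fc; rewrite // divr_gt0// !mulr_gt0.
have E : (f s)^-1 - (f t)^-1 = (f s)^-1 * (f t - f s) * (f t)^-1.
  by rewrite mulrBr mulrBl -mulrA mulrV ?fu// mulr1 mulVr ?fu// mul1r.
pose c := cnorm (f s)^-1; pose d := cnorm (f s - f t).
have c0 : 0 <= c by exact: cnorm_ge0.
have d0 : 0 <= d by exact: cnorm_ge0.
have Ele : cnorm ((f s)^-1 - (f t)^-1) <= c * d * a.
  rewrite E (le_trans (cnormM _ _))// ler_pM ?cnorm_ge0//.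
  by rewrite (le_trans (cnormM _ _))// [cnorm (f t - f s)]cnorm_distC.
(* An a priori bound on the inverse at s: in c <= c d a + a, the estimate d a <= 1/2 lets half of c
   be absorbed on the left. *)
have c2a : c <= 2 * a.
  have h1 : c <= c * d * a + a.
    by rewrite /c -{1}(subrK (f t)^-1 (f s)^-1) (le_trans (cnormD _ _))// lerD.
  have h2 : d * a <= 2^-1.
    by rewrite -ler_pdivlMr// -invfM ltW.
  have := ler_wpM2l c0 h2; rewrite mulrA; lra.
rewrite (le_lt_trans Ele)//.
apply: (@le_lt_trans _ _ (2 * a * d * a)).
  by rewrite -[leLHS]mulrA -[leRHS]mulrA ler_wpM2r// mulr_ge0// ltW.
by rewrite mulrAC mulrC -ltr_pdivlMr// !mulr_gt0.
Unshelve. all: by end_near. Qed.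

Lemma path_sum (I : Type) (s : seq I) (P : pred I) (F : I -> R -> A) :
  (forall i, path_continuous (F i)) ->
  path_continuous (fun t => \sum_(i <- s | P i) F i t).
Proof.
move=> Fc; elim: s => [|i s IH].
  by under eq_fun do rewrite big_nil; exact: path_cst.
under eq_fun do rewrite big_cons; case: (P i) => //; exact: pathD.
Qed.

End Paths.

(** * Unitary matrices and their homotopies *)

Section MatrixPaths.
Context {R : realType} {A : cstarAlgType R}.

Lemma within_continuous_mxP m n (h : R -> 'M[normed_space A]_(m, n)) :
  {within `[0, 1], continuous h} <->
  forall i j, path_continuous (fun t => h t i j : A).
Proof.
rewrite subspace_continuousP; split=> [hc i j t t01 e e0|hc t t01].
  have eC0 : 0 < e%:C by rewrite ltcR.
  have /cvg_mx_entourageP/(_ _ (entourage_ball _ (PosNum eC0))) := hc t t01.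
  rewrite near_simpl/= => ht; apply: (@filterS _ _ _ _ _ _ ht) => s /(_ i j).
  by rewrite inE/= -ball_normE/= /Num.norm/= ltcR cnorm_distC.
apply/cvg_mx_entourageP => E; rewrite -entourage_ballE => -[[e e']] /=.
rewrite ltcE/= => /andP[/eqP-> e0] sE.
apply: filter_forall => i; apply: filter_forall => j.
apply: filterS (hc i j t t01 e e0) => s hs; apply/mem_set/sE => /=.
by rewrite -ball_normE/= /Num.norm/= ltcR cnorm_distC.
Qed.

Lemma starmxK m n (u : 'M[A]_(m, n)) : starmx (starmx u) = u.
Proof. by apply/matrixP => i j; rewrite !mxE starK. Qed.

Lemma starmxM m n p (u : 'M[A]_(m, n)) (v : 'M[A]_(n, p)) :
  starmx (u *m v) = starmx v *m starmx u.
Proof.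
apply/matrixP => i j; rewrite !mxE star_sum.
by apply: eq_bigr => k _; rewrite !mxE starM.
Qed.

Lemma starmxD m n (u v : 'M[A]_(m, n)) : starmx (u + v) = starmx u + starmx v.
Proof. by apply/matrixP => i j; rewrite !mxE starD. Qed.

Lemma starmx1 n : starmx (1%:M : 'M[A]_n) = 1%:M.
Proof.
apply/matrixP => i j; rewrite !mxE eq_sym.
by case: (i == j); rewrite ?star1 ?star0.
Qed.

Lemma unitary_starmx n (u : 'M[A]_n) : unitary u -> unitary (starmx u).
Proof. by case=> uu' u'u; split; rewrite starmxK. Qed.

Lemma unitaryM n (u v : 'M[A]_n) : unitary u -> unitary v -> unitary (u *m v).
Proof.
move=> [u'u uu'] [v'v vv']; split; rewrite starmxM.
  by rewrite mulmxA -(mulmxA _ _ u) u'u mulmx1.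
by rewrite mulmxA -(mulmxA u) vv' mulmx1.
Qed.

Lemma path_mulmx m n p (g : R -> 'M[A]_(m, n)) (h : R -> 'M[A]_(n, p)) :
  (forall i j, path_continuous (fun t => g t i j)) ->
  (forall i j, path_continuous (fun t => h t i j)) ->
  forall i j, path_continuous (fun t => (g t *m h t) i j).
Proof.
move=> gc hc i j; under eq_fun do rewrite mxE.
by apply: path_sum => k; exact: pathM.
Qed.

Lemma path_starmx m n (g : R -> 'M[A]_(m, n)) :
  (forall i j, path_continuous (fun t => g t i j)) ->
  forall i j, path_continuous (fun t => (starmx (g t)) i j).
Proof. by move=> gc i j; under eq_fun do rewrite !mxE; exact: path_star. Qed.

Lemma unitary_homotopic_refl n (u : 'M[A]_n) : unitary u -> unitary_homotopic u u.
Proof.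
move=> uu; exists (fun=> u); split=> //; apply/within_continuous_mxP => i j.
exact: path_cst.
Qed.

Lemma unitary_homotopicM n (u u' v v' : 'M[A]_n) :
  unitary_homotopic u u' -> unitary_homotopic v v' ->
  unitary_homotopic (u *m v) (u' *m v').
Proof.
move=> [g [/within_continuous_mxP gc gu g0 g1]].
move=> [h [/within_continuous_mxP hc hu h0 h1]].
exists (fun t => (g t : 'M[A]_n) *m (h t : 'M[A]_n)); split.
- by apply/within_continuous_mxP; exact: path_mulmx.
- by move=> t t01; apply: unitaryM; [exact: gu | exact: hu].
- by rewrite g0 h0.
- by rewrite g1 h1.
Qed.

Lemma unitary_homotopic_unitary n (u v : 'M[A]_n) : unitary_homotopic u v ->
  unitary u /\ unitary v.
Proof.
move=> [h [_ hu <- <-]].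
by split; apply: hu; rewrite in_itv/= lexx ler01.
Qed.

Lemma unitary_homotopic_starmx n (u v : 'M[A]_n) : unitary_homotopic u v ->
  unitary_homotopic (starmx u) (starmx v).
Proof.
move=> [g [/within_continuous_mxP gc gu g0 g1]].
exists (fun t => starmx (g t : 'M[A]_n)); split.
- by apply/within_continuous_mxP; exact: path_starmx.
- by move=> t t01; apply/unitary_starmx/gu.
- by rewrite g0.
- by rewrite g1.
Qed.

(* Homotopies are inverted and concatenated by pointwise multiplication in the
   unitary group: u h^* v runs from v to u, and g v^* h from u to w. *)
Lemma unitary_homotopic_sym n (u v : 'M[A]_n) : unitary_homotopic u v ->
  unitary_homotopic v u.
Proof.
move=> uv; have [uu uv'] := unitary_homotopic_unitary uv.
have := unitary_homotopicM
  (unitary_homotopicM (unitary_homotopic_refl uu) (unitary_homotopic_starmx uv))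
  (unitary_homotopic_refl uv').
case: uu uv' => _ -> [v'v _]; rewrite mul1mx.
by rewrite -mulmxA v'v mulmx1.
Qed.

Lemma unitary_homotopic_trans n (v u w : 'M[A]_n) : unitary_homotopic u v ->
  unitary_homotopic v w -> unitary_homotopic u w.
Proof.
move=> uv vw; have [_ uv'] := unitary_homotopic_unitary uv.
have := unitary_homotopicM (unitary_homotopicM uv
  (unitary_homotopic_refl (unitary_starmx uv'))) vw.
by case: uv' => v'v vv'; rewrite -mulmxA v'v mulmx1 vv' mul1mx.
Qed.

End MatrixPaths.

(** * Contracting a unitary by a Moebius transform *)

Section Moebius.
Context {R : realType} {A : cstarAlgType R}.

Definition real_mx n (r : R) : 'M[A]_n := (r%:C%:A)%:M.

(** Scalar matrices over a noncommutative ring are not central in general; this one is, its entry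
    being a complex multiple of 1. *)
Lemma real_mxC n (r : R) (Z : 'M[A]_n) : real_mx n r *m Z = Z *m real_mx n r.
Proof.
apply/matrixP => i j.
rewrite /real_mx mul_scalar_mx -diag_const_mx mul_mx_diag !mxE.
by rewrite -scalerAl mul1r -scalerAr mulr1.
Qed.

Lemma starmx_real n (r : R) : starmx (real_mx n r) = real_mx n r.
Proof.
apply/matrixP => i j; rewrite !mxE eq_sym.
by case: (i == j); rewrite ?mulr1n ?mulr0n ?star0// starZr star1.
Qed.

(** The path is (t + Z)(1 + t Z)^-1. With Z' the adjoint of Z, the sum Z + Z' is diagonal, so
    inverting (1 + t Z')(1 + t Z) = 1 + t^2 + t (Z + Z') only takes inverses in A, whose continuity
    is [pathV]. *)
Lemma moebius_homotopic n (Z : 'M[A]_n) (d : 'rV[A]_n) :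
  unitary Z -> Z + starmx Z = diag_mx d ->
  (forall t : R, t \in `[0, 1] -> forall i,
    1 + (t%:C%:A) ^+ 2 + t%:C%:A * d 0 i \is a GRing.unit) ->
  unitary_homotopic Z 1%:M.
Proof.
move=> [Z'Z ZZ'] Zd du.
pose H t i : A := 1 + (t%:C%:A) ^+ 2 + t%:C%:A * d 0 i.
pose D t : 'M[A]_n := diag_mx (\row_i (H t i)^-1).
pose c := real_mx n.
(* The numerator is (t + Z)(1 + t Z'), Z' the adjoint of Z, expanded with Z Z' = 1. *)
pose V t : 'M[A]_n := (c t *+ 2 + Z + c t ^+ 2 * starmx Z) * D t.
have HE t : 1 + c t ^+ 2 + c t * (Z + starmx Z) = diag_mx (\row_i H t i).
  rewrite Zd expr2 -!mulmxE /c /real_mx -scalar_mxM mul_scalar_mx.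
  apply/matrixP => i j; rewrite !mxE /H expr2.
  by case: (i == j); rewrite ?mulr1n// !mulr0n mulr0 !addr0.
have diag1 (f : 'I_n -> A) : (forall i, f i = 1) -> diag_mx (\row_i f i) = 1.
  move=> f1; rewrite -idmxE -diag_const_mx; congr diag_mx.
  by apply/rowP => i; rewrite !mxE.
have HD t : t \in `[0, 1] -> (1 + c t ^+ 2 + c t * (Z + starmx Z)) * D t = 1.
  move=> t01; rewrite HE -mulmxE mulmx_diag; apply: diag1 => i.
  by rewrite !mxE mulrV// du.
have DH t : t \in `[0, 1] -> D t * (1 + c t ^+ 2 + c t * (Z + starmx Z)) = 1.
  move=> t01; rewrite HE -mulmxE mulmx_diag; apply: diag1 => i.
  by rewrite !mxE mulVr// du.
have starD t : t \in `[0, 1] -> starmx (D t) = D t.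
  move=> t01; apply/matrixP => i j; rewrite !mxE eq_sym.
  case: (eqVneq i j) => [->|]; last by rewrite !mulr0n star0.
  rewrite !mulr1n star_inv ?du//; congr (_^-1).
  (* The diagonal of a sum of Z and its adjoint is self-adjoint, hence so are the entries of D. *)
  have dj : d 0 j = Z j j + (Z j j)^#*.
    by have /matrixP/(_ j j) := Zd; rewrite !mxE eqxx mulr1n.
  rewrite /H !starD starX starM !starZr !star1 dj starD starK [(Z j j)^#* + _]addrC.
  by rewrite -!scalerAl -!scalerAr !mul1r !mulr1.
have cZ t : GRing.comm (c t) Z by exact: real_mxC.
have cZ' t : GRing.comm (c t) (starmx Z) by exact: real_mxC.
have starV t : t \in `[0, 1] ->
    starmx (V t) = D t * (c t *+ 2 + starmx Z + c t ^+ 2 * Z).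
  move=> t01; rewrite /V -mulmxE starmxM starD// !mulr2n !expr2 -!mulmxE.
  by rewrite !starmxD !starmxM starmxK !starmx_real !mulmxE (mulrA Z) -cZ -(mulrA _ Z) -cZ mulrA.
have c_cont i j : path_continuous (fun t => c t i j).
  under eq_fun do rewrite mxE; case: (i == j); first exact: path_id.
  exact: path_cst.
have H_cont i : path_continuous (H^~ i).
  apply: pathD; first apply: pathD; rewrite ?expr2.
  - exact: path_cst.
  - by apply: pathM; exact: path_id.
  - by apply: pathM; [exact: path_id | exact: path_cst].
exists V; split.
- apply/within_continuous_mxP; apply: path_mulmx => i j.
    under eq_fun do rewrite 2!mxE.
    apply: pathD; first apply: pathD.
    + by under eq_fun do rewrite mulr2n mxE; apply: pathD; exact: c_cont.
    + exact: path_cst.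
    + apply: path_mulmx => k l; last exact: path_cst.
      by under eq_fun do rewrite expr2; apply: path_mulmx => ? ?; exact: c_cont.
  under eq_fun do rewrite !mxE; case: (i == j); last exact: path_cst.
  exact: (pathV (H_cont i) (fun t t01 => du t t01 i)).
- move=> t t01; have [VV' DW] := moebius_inverse (cZ t) (cZ' t) ZZ' Z'Z (HD _ t01) (DH _ t01).
  (* Exchanging Z with its adjoint gives the product in the other order, once D is moved across both
     numerators. *)
  have := moebius_inverse (cZ' t) (cZ t) Z'Z ZZ'.
  rewrite [starmx Z + Z]addrC => /(_ _ (HD _ t01) (DH _ t01))[V'V DW'].
  by split; rewrite starV// DW // /V -DW'.
- have c0 : c 0 = 0 by rewrite /c /real_mx scale0r; apply/matrixP => i j; rewrite !mxE mul0rn.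
  have := HD 0; rewrite in_itv/= lexx ler01 /V c0 expr0n/= !mul0r mul0rn !addr0 add0r mul1r.
  by move=> ->//; rewrite mulr1.
(* At t = 1 the numerator, 2 plus Z plus its adjoint, equals the denominator. *)
- have c1 : c 1 = 1 by rewrite /c /real_mx scale1r.
  have := HD 1; rewrite in_itv/= lexx ler01 /V c1 expr1n/= !mul1r addrA mulr2n.
  exact.
Qed.

End Moebius.

(** * Two-by-two matrices over the algebra *)

Section TwoByTwo.
Context {R : realType} {A : cstarAlgType R}.

(** The case analysis copies that of [Umx], which is therefore convertible to an instance of
    [mx2]. *)
Definition mx2 (a b c d : A) : 'M[A]_2 := \matrix_(i, j)
  if i == 0 then if j == 0 then a else b
  else if j == 0 then c else d.

Lemma mx2M (b11 b12 b21 b22 c11 c12 c21 c22 : A) :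
  mx2 b11 b12 b21 b22 *m mx2 c11 c12 c21 c22 =
  mx2 (b11 * c11 + b12 * c21) (b11 * c12 + b12 * c22)
      (b21 * c11 + b22 * c21) (b21 * c12 + b22 * c22).
Proof.
apply/matrixP => i j; rewrite !mxE !big_ord_recl big_ord0 addr0 !mxE/=.
by case: (i == 0); case: (j == 0).
Qed.

Lemma starmx_mx2 (b11 b12 b21 b22 : A) :
  starmx (mx2 b11 b12 b21 b22) = mx2 b11^#* b21^#* b12^#* b22^#*.
Proof.
by apply/matrixP => i j; rewrite !mxE; case: (i == 0); case: (j == 0).
Qed.

Lemma mx2_1 : mx2 1 0 0 1 = 1%:M.
Proof.
by apply/matrixP => -[[|[|?]]// ?] [[|[|?]]// ?]; rewrite !mxE.
Qed.

Lemma mx2D (b11 b12 b21 b22 c11 c12 c21 c22 : A) :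
  mx2 b11 b12 b21 b22 + mx2 c11 c12 c21 c22 =
  mx2 (b11 + c11) (b12 + c12) (b21 + c21) (b22 + c22).
Proof.
by apply/matrixP => i j; rewrite !mxE; case: (i == 0); case: (j == 0).
Qed.

Lemma mx2_diag (u v : A) : mx2 u 0 0 v = diag_mx (\row_i if i == 0 then u else v).
Proof.
by apply/matrixP => -[[|[|?]]// ?] [[|[|?]]// ?]; rewrite !mxE.
Qed.

Lemma stab_mx2 (u : A) : stab 1 (u%:M : 'M[A]_1) = mx2 u 0 0 1.
Proof.
apply/matrixP => i j; rewrite /stab.
case: (@split_ordP 1 1 i) => i' ->; case: (@split_ordP 1 1 j) => j' ->.
- by rewrite [LHS](@block_mxEul _ 1 1 1 1) !ord1 !mxE.
- by rewrite [LHS](@block_mxEur _ 1 1 1 1) !ord1 !mxE.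
- by rewrite [LHS](@block_mxEdl _ 1 1 1 1) !ord1 !mxE.
- by rewrite [LHS](@block_mxEdr _ 1 1 1 1) !ord1 !mxE.
Qed.

End TwoByTwo.

(** * The relations of SU_q(2): norm bound, projection, homotopy *)

Section Relations.
Context {R : realType} (q : R) {A : cstarAlgType R} (a g : A).
Context (q01 : 0 < q < 1) (rel : SUq2_relations q a g).

Let x := g^#* * g.

Let q0 : 0 < q. Proof. by case/andP: q01. Qed.
Let q1 : q < 1. Proof. by case/andP: q01. Qed.

Let ag : a * g = q%:C *: (g * a). Proof. exact: SUq2_ag rel. Qed.
Let ag' : a * g^#* = q%:C *: (g^#* * a). Proof. exact: SUq2_ags rel. Qed.
Let gg' : g * g^#* = g^#* * g. Proof. exact: SUq2_gg rel. Qed.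
Let ga' : g * a^#* = q%:C *: (a^#* * g).
Proof. by have := congr1 star ag'; rewrite starM starZr starM !starK. Qed.
Let g'a' : g^#* * a^#* = q%:C *: (a^#* * g^#*).
Proof. by have := congr1 star ag; rewrite starM starZr starM. Qed.
Let a'a : a^#* * a = 1 - x.
Proof. by rewrite -(SUq2_sphere rel) addrK. Qed.
Let aa' : a * a^#* = 1 - (q ^+ 2)%:C *: x.
Proof. by rewrite -(SUq2_sphere_q rel) gg' addrK. Qed.
Let x_sa : x^#* = x. Proof. by rewrite /x starM starK. Qed.
Let xa' : x * a^#* = (q ^+ 2)%:C *: (a^#* * x).
Proof.
rewrite /x -mulrA ga' -scalerAr (mulrA g^#*) g'a' -scalerAl scalerA -rmorphM -expr2.
by rewrite mulrA.
Qed.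

Let xa'n n : x * a^#* ^+ n = (q ^+ (2 * n))%:C *: (a^#* ^+ n * x).
Proof.
elim: n => [|n IH]; first by rewrite scale1r mul1r mulr1.
rewrite exprSr (mulrA x) IH -scalerAl -(mulrA _ x) xa' -scalerAr scalerA -rmorphM -exprD.
by rewrite mulrA mulnS addnC.
Qed.

(** Positivity of 1 - x would yield |x| <= 1. Growth of the powers of x yields |x| <= 1/q without
    any order theory, and this suffices: (q |g|)^2 = q^2 |x| <= q < 1. *)
Lemma cnorm_gamma_lt : q * cnorm g < 1.
Proof.
pose y n := a^#* ^+ n * a ^+ n.
(* With a' the adjoint of a, y_n - y_(n+1) = a'^n (1 - a' a) a^n = a'^n x a^n. *)
have xy n : x * y n = (q ^+ (2 * n))%:C *: (y n - y n.+1).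
  rewrite /y mulrA xa'n -scalerAl; congr (_ *: _).
  rewrite exprSr exprS (mulrA (_ * a^#*)) -(mulrA _ a^#*) a'a mulrBr mulr1 mulrBl.
  by rewrite opprB addrC subrK.
(* Any rate strictly between 1 and q^-2 would serve the final bound; q^-1 is one. *)
have [C xC] : exists C, forall N, cnorm (x ^+ N * y 0%N) <= C * q^-1 ^+ N.
  apply: (@geometric_growth _ q (cnorm a ^+ 2) _ (fun N n => cnorm (x ^+ N * y n)))
    => // [||n|N n|N n].
  - by rewrite invf_gt1.
  - exact: sqr_ge0.
  - rewrite mul1r /y -starX cnorm_star -exprM mulnC exprM.
    by rewrite lerXn2r ?nnegrE ?exprn_ge0 ?cnorm_ge0// cnormX.
  - rewrite exprSr -mulrA xy -scalerAr cnormZr ger0_norm ?exprn_ge0 ?(ltW q0)//.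
    by rewrite ler_wpM2l ?exprn_ge0 ?(ltW q0)// mulrBr cnormB.
  - exact: cnorm_ge0.
have xq : cnorm x <= q^-1.
  apply: (@cnorm_selfadjoint_le _ _ _ C) => //; first by rewrite invr_gt0.
  by move=> n; have := xC n; rewrite /y !expr0 !mulr1.
have : (q * cnorm g) ^+ 2 < 1.
  rewrite exprMn -cnorm_star (le_lt_trans _ q1)//.
  by rewrite expr2 -mulrA ler_piMr ?(ltW q0)// -ler_pdivlMl// mulr1.
by rewrite expr_lt1// mulr_ge0 ?cnorm_ge0// ltW.
Qed.

Lemma aa'_unit : a * a^#* \is a GRing.unit.
Proof.
rewrite aa'; apply: neumann_unit; rewrite cnormZr ger0_norm ?sqr_ge0//.
rewrite /x cnorm_star -exprMn expr_lt1 ?cnorm_gamma_lt//.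
by rewrite mulr_ge0 ?cnorm_ge0// ltW.
Qed.

(** Up to the factor 1 + t^2 this is 1 - y with |y| <= (2 t / (1 + t^2)) q |g| <= q |g| < 1. *)
Lemma den_unit (t : R) : t \in `[0, 1] ->
  1 + t%:C%:A ^+ 2 + t%:C%:A * (q%:C *: (g + g^#*)) \is a GRing.unit.
Proof.
rewrite in_itv/= => /andP[t0 t1].
have tt : 0 < 1 + t ^+ 2 by rewrite ltr_pwDl// sqr_ge0.
pose s := t / (1 + t ^+ 2) * q.
have s0 : 0 <= s by rewrite !mulr_ge0 ?invr_ge0// ltW.
rewrite (_ : _ + _ = (1 + t ^+ 2)%:C *: (1 - (- (s%:C *: (g + g^#*))))); last first.
  have -> : (1 + t ^+ 2)%:C *: (1 - - (s%:C *: (g + g^#*))) =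
      (1 + t ^+ 2)%:C%:A + (t * q)%:C *: (g + g^#*).
    rewrite opprK scalerDr scalerA -rmorphM; congr (_ + _%:C *: _).
    by rewrite /s; field; rewrite lt0r_neq0.
  rewrite rmorphD scalerDl scale1r expr2 -!scalerAl !mul1r !scalerA -!rmorphM.
  by rewrite expr2.
rewrite scaler_unit; last by rewrite unitfE -(rmorph0 (real_complex R)) (inj_eq (@complexI _)) lt0r_neq0.
apply: neumann_unit; rewrite cnormN cnormZr ger0_norm//.
apply: (@le_lt_trans _ _ (q * cnorm g)); last exact: cnorm_gamma_lt.
apply: (@le_trans _ _ (s * (2 * cnorm g))).
  by rewrite ler_wpM2l// (le_trans (cnormD _ _))// cnorm_starE mulr2n mulrDl mul1r.
rewrite mulrA ler_wpM2r ?cnorm_ge0// /s mulrAC ler_piMl ?(ltW q0)//.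
rewrite mulrAC ler_pdivrMr// mul1r; nra.
Qed.

Let e := (a * a^#*)^-1.
Let p := 1 - a^#* * e * a.

Let aa'U : a * a^#* \is a GRing.unit. Proof. exact: aa'_unit. Qed.
Let e_sa : e^#* = e. Proof. by rewrite /e star_inv// starM starK. Qed.
Let p_sa : p^#* = p.
Proof. by rewrite /p starB star1 !starM starK e_sa mulrA. Qed.
Let ap : a * p = 0.
Proof. by rewrite /p mulrBr mulr1 !mulrA /e mulrV// mul1r subrr. Qed.
Let pa' : p * a^#* = 0.
Proof. by rewrite -p_sa -starM ap star0. Qed.
Let pp : p * p = p.
Proof. by rewrite {2}/p mulrBr mulr1 !mulrA pa' !mul0r subr0. Qed.
Let gx : GRing.comm g x.
Proof. by rewrite /GRing.comm /x mulrA gg'. Qed.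
Let g'x : GRing.comm g^#* x.
Proof. by rewrite /GRing.comm /x -[RHS]mulrA gg'. Qed.
Let comm_aa' c : GRing.comm c x -> GRing.comm c (a * a^#*).
Proof.
by move=> cx; rewrite aa'; apply: commrB; [exact: commr1|]; rewrite /GRing.comm -scalerAl -scalerAr cx.
Qed.
Let ge : g * e = e * g. Proof. exact/commrV/comm_aa'. Qed.
Let g'e : g^#* * e = e * g^#*. Proof. exact/commrV/comm_aa'. Qed.
(** With a' the adjoint of a, both a' e a g and g a' e a equal q a' e g a. *)
Let pg : GRing.comm p g.
Proof.
rewrite /GRing.comm /p mulrBl mulrBr mul1r mulr1; congr (_ - _).
rewrite -!mulrA ag -!scalerAr (mulrA g) ga' -scalerAl (mulrA e g) -ge.
by rewrite -!mulrA.
Qed.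
Let pg' : GRing.comm p g^#*.
Proof. by rewrite /GRing.comm -p_sa -starM -pg starM. Qed.
(** With a' the adjoint of a, p (1 - x) = p a' a = 0. *)
Let px : p * x = p.
Proof. by apply/eqP; rewrite -subr_eq0 -opprB oppr_eq0 -{1}[p]mulr1 -mulrBr -a'a mulrA pa' mul0r. Qed.

Let qp : (1 - p) * p = 0. Proof. by rewrite mulrBl mul1r pp subrr. Qed.
Let pq : p * (1 - p) = 0. Proof. by rewrite mulrBr mulr1 pp subrr. Qed.
Let qq : (1 - p) * (1 - p) = 1 - p. Proof. by rewrite mulrBl mul1r pq subr0. Qed.
(** The element 1 - p + p u acts as 1 off p and as u on p; with p x = p this makes w unitary. *)
Let cornerM u v : GRing.comm p u ->
  (1 - p + p * u) * (1 - p + p * v) = 1 - p + p * (u * v).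
Proof.
move=> pu; move: qp pq qq; move: (1 - p) => P Pp pP PP.
rewrite mulrDl !mulrDr PP (mulrA P p) Pp mul0r addr0 pu.
rewrite -(mulrA u p P) pP mulr0 add0r mulrA -(mulrA u p p) pp -pu.
by rewrite -mulrA.
Qed.

Let w := wtilde a g.
Let wE : w = 1 - p + p * g.
Proof. by rewrite /w /wtilde -/e -/p mulrBl mul1r addrA addrAC pg. Qed.
Let w'E : w^#* = 1 - p + p * g^#*.
Proof. by rewrite wE starD starB star1 starM p_sa pg'. Qed.

Lemma wtilde_unitary : unitary (w%:M : 'M[A]_1).
Proof.
have E : starmx w%:M = w^#*%:M :> 'M[A]_1.
  by apply/matrixP => i j; rewrite !mxE !ord1 eqxx.
have sM (u v : A) : u%:M *m v%:M = (u * v)%:M :> 'M[A]_1 by rewrite -scalar_mxM.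
by split; rewrite E sM w'E wE cornerM// ?gg' px subrK.
Qed.

Lemma Umx_unitary : unitary (Umx q a g).
Proof.
change (Umx q a g) with (mx2 a (- (q%:C *: g^#*)) g a^#*).
split; rewrite starmx_mx2 mx2M -mx2_1; congr mx2;
  rewrite ?starN ?starZr ?starK ?mulrN ?mulNr ?opprK -?scalerAl -?scalerAr ?scalerA.
- exact: SUq2_sphere rel.
- by rewrite g'a' addrC subrr.
- by rewrite ag addrC subrr.
- by rewrite -rmorphM -expr2 addrC; exact: SUq2_sphere_q rel.
- by rewrite -rmorphM -expr2 -gg'; exact: SUq2_sphere_q rel.
- by rewrite ag' subrr.
- by rewrite ga' subrr.
- by rewrite gg' addrC; exact: SUq2_sphere rel.
Qed.

Let J : 'M[A]_2 := mx2 0 (- 1) 1 0.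
Let W : 'M[A]_2 := mx2 w 0 0 1.
Let Z : 'M[A]_2 := mx2 (p + (1 - p) * g) a^#* (- a) (q%:C *: g^#*).

Let J_unitary : unitary J.
Proof.
by split; rewrite starmx_mx2 mx2M -mx2_1; congr mx2;
  rewrite ?starN ?star0 ?star1 !(mul0r, mulr0, mul1r, mulr1, mulrN, mulNr, opprK, oppr0, add0r, addr0).
Qed.

Let ww' : w * w^#* = 1.
Proof. by rewrite w'E wE cornerM// gg' px subrK. Qed.
Let w'w : w^#* * w = 1.
Proof. by rewrite w'E wE cornerM// px subrK. Qed.

Let W_unitary : unitary W.
Proof.
by split; rewrite starmx_mx2 mx2M -mx2_1; congr mx2;
  rewrite ?star0 ?star1 !(mul0r, mulr0, mul1r, mulr1, add0r, addr0) ?ww' ?w'w.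
Qed.

(** With primes for adjoints, the top row uses w' g = p + (1 - p) g, from p x = p, and w' a' = a',
    from p a' = 0. *)
Let ZE : starmx W *m (starmx J *m Umx q a g) = Z.
Proof.
change (Umx q a g) with (mx2 a (- (q%:C *: g^#*)) g a^#*).
rewrite !starmx_mx2 !mx2M; congr mx2;
  rewrite ?starN ?star0 ?star1 !(mul0r, mulr0, mul1r, mulr1, mulrN, mulNr, opprK, oppr0, add0r, addr0) //.
- rewrite w'E mulrDl addrC; congr (_ + _).
  by rewrite -mulrA px.
- by rewrite w'E mulrDl pg' -mulrA pa' mulr0 addr0 mulrBl mul1r pa' subr0.
Qed.

Let Z_unitary : unitary Z.
Proof.
rewrite -ZE; apply: unitaryM; first exact: unitary_starmx.
by apply: unitaryM; [exact: unitary_starmx | exact: Umx_unitary].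
Qed.

Let UE : Umx q a g = J *m (W *m Z).
Proof.
have [_ JJ'] := J_unitary; have [_ WW'] := W_unitary.
by rewrite -ZE (mulmxA W) WW' mul1mx mulmxA JJ' mul1mx.
Qed.

Let J_homotopic : unitary_homotopic J 1%:M.
Proof.
(* J plus its adjoint is 0; the zero row is a conditional so as to match [mx2_diag]. *)
apply: (@moebius_homotopic _ _ _ _ (\row_i if i == 0 then 0 else 0)) => //.
  by rewrite starmx_mx2 mx2D -mx2_diag starN star1 !star0 addr0 addNr subrr.
move=> t _ i; rewrite mxE if_same mulr0 addr0.
have tt : 0 < 1 + t ^+ 2 by rewrite ltr_pwDl// sqr_ge0.
have -> : 1 + t%:C%:A ^+ 2 = (1 + t ^+ 2)%:C%:A :> A.
  by rewrite rmorphD scalerDl scale1r !expr2 -scalerAl mul1r scalerA -rmorphM.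
rewrite scaler_unit ?unitr1//.
by rewrite unitfE -(rmorph0 (real_complex R)) (inj_eq (@complexI _)) lt0r_neq0.
Qed.

(** [num] and [den] are 1 + t^2 + t d for the two diagonal entries d of Z plus its adjoint. *)
Let den (t : R) : A := 1 + t%:C%:A ^+ 2 + t%:C%:A * (q%:C *: (g + g^#*)).
Let num (t : R) : A := 1 + t%:C%:A ^+ 2 + t%:C%:A * (p *+ 2 + (1 - p) * (g + g^#*)).

Let realE (t : R) (h : A) :
  1 + t%:C%:A ^+ 2 + t%:C%:A * h = (1 + t ^+ 2)%:C%:A + t%:C *: h.
Proof.
rewrite rmorphD scalerDl scale1r !expr2 -!scalerAl !mul1r scalerA.
by rewrite -rmorphM.
Qed.

Let num_unit (t : R) : t \in `[0, 1] -> num t \is a GRing.unit.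
Proof.
move=> t01; have dU := den_unit t01.
have t1 : 1 + t != 0.
  by rewrite lt0r_neq0// ltr_pwDl//; move: t01; rewrite in_itv => /andP[].
pose r := ((1 + t) ^- 2)%:C.
have ah : a * (g + g^#*) = q%:C *: ((g + g^#*) * a).
  by rewrite mulrDr ag ag' -scalerDr -mulrDl.
have ha' : (g + g^#*) * a^#* = q%:C *: (a^#* * (g + g^#*)).
  by rewrite mulrDl ga' g'a' -scalerDr -mulrDr.
have aq : a * (1 - p) = a by rewrite mulrBr mulr1 ap subr0.
have qa' : (1 - p) * a^#* = a^#* by rewrite mulrBl mul1r pa' subr0.
have hp : (g + g^#*) * p = p * (g + g^#*) by apply/esym/commrD.
have an : a * num t = den t * a.
  rewrite /num /den !realE (mulrDr a) (mulrDl _ _ a) -!scalerAr -!scalerAl mulr1 mul1r.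
  by rewrite (mulrDr a) mulrnAr ap mul0rn add0r mulrA aq ah.
have na' : num t * a^#* = a^#* * den t.
  rewrite /num /den !realE (mulrDr a^#*) (mulrDl _ _ a^#*) -!scalerAr -!scalerAl mulr1 mul1r.
  by rewrite (mulrDl _ _ a^#*) mulrnAl pa' mul0rn add0r -mulrA ha' -scalerAr mulrA qa'.
(* On p, [num t] acts as the scalar 1 + t^2 + 2 t = (1 + t)^2, which [r] inverts. *)
have square : (1 + t ^+ 2)%:C *: p + t%:C *: (p *+ 2) = ((1 + t) ^+ 2)%:C *: p.
  rewrite -scalerMnr scalerMnl -scalerDl -rmorphMn -rmorphD; congr (_%:C *: _).
  by ring.
have pn : p * num t = ((1 + t) ^+ 2)%:C *: p.
  rewrite /num realE (mulrDr p) -!scalerAr mulr1.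
  by rewrite (mulrDr p) mulrnAr pp mulrA pq mul0r addr0.
have np : num t * p = ((1 + t) ^+ 2)%:C *: p.
  rewrite /num realE (mulrDl _ _ p) -!scalerAl mul1r.
  by rewrite (mulrDl _ _ p) mulrnAl pp -mulrA hp mulrA qp mul0r addr0.
have de : den t * e = e * den t.
  rewrite /den realE mulrDl mulrDr -!scalerAl -!scalerAr mulr1 mul1r.
  by rewrite mulrDl mulrDr ge g'e.
have rp : r *: (((1 + t) ^+ 2)%:C *: p) = p.
  by rewrite scalerA -rmorphM mulVf ?scale1r// sqrf_eq0.
(* [a] intertwines [num] with [den], which inverts [num] off [p]. *)
apply/unitrP; exists (r *: p + a^#* * e * (den t)^-1 * a); split.
  rewrite mulrDl -scalerAl pn rp -(mulrA _ a) an mulrA -(mulrA _ _ (den t)) mulVr//.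
  by rewrite mulr1 subrK.
rewrite mulrDr -scalerAr np rp !mulrA na' -(mulrA _ (den t)) de -(mulrA _ _ _^-1).
by rewrite -(mulrA e) mulrV// mulr1 subrK.
Qed.

Lemma SUq2_homotopic : unitary_homotopic (Umx q a g) W.
Proof.
rewrite UE -[X in unitary_homotopic _ X]mul1mx -[X in unitary_homotopic _ (_ *m X)]mulmx1.
(* In U = J W Z the outer factors are contracted to 1 while W stays fixed. *)
apply: unitary_homotopicM => //; apply: unitary_homotopicM.
  exact: unitary_homotopic_refl.
apply: (@moebius_homotopic _ _ _ _
  (\row_i if i == 0 then p *+ 2 + (1 - p) * (g + g^#*) else q%:C *: (g + g^#*))) => //.
  rewrite -mx2_diag starmx_mx2 mx2D starN starK starZr starK; congr mx2.
  - rewrite starD p_sa starM starB star1 p_sa addrACA -mulr2n (mulrDr _ g); congr (_ + (_ + _)).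
    by rewrite mulrBr mulrBl mulr1 mul1r pg'.
  - by rewrite subrr.
  - by rewrite addNr.
  - by rewrite -scalerDr addrC.
move=> t t01 i; rewrite mxE; case: (i == 0); first exact: num_unit.
exact: den_unit.
Qed.

End Relations.

(** * Stabilization and classes in K_1 *)

Section Stabilization.
Context {R : realType} {A : cstarAlgType R}.

(** This is [stab] with the target size as a parameter, which avoids casts between sizes that are
    only provably equal. Indices from n on fail [insub] and fill the identity block. *)
Definition pad n N (u : 'M[A]_n) : 'M[A]_N := \matrix_(i, j)
  match insub (i : nat), insub (j : nat) with
  | Some i', Some j' => u i' j'
  | _, _ => (i == j)%:R
  end.

Lemma castmx_stab n k N (e : (n + k)%N = N) (u : 'M[A]_n) :
  castmx (e, e) (stab k u) = pad N u.
Proof.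
case: N / e; rewrite castmx_id; apply/matrixP => i j; rewrite /stab [RHS]mxE.
have big (l : 'I_k) : insub (rshift n l : nat) = None :> option 'I_n.
  by rewrite insubF//= ltnNge leq_addr.
case: (split_ordP i) => i' ->; case: (split_ordP j) => j' ->;
  rewrite ?block_mxEul ?block_mxEur ?block_mxEdl ?block_mxEdr ?big.
- by rewrite /= (valK i') (valK j').
- by rewrite /= (valK i') mxE eq_lrshift.
- by rewrite mxE eq_rlshift.
- by rewrite mxE eq_rshift.
Qed.

Lemma pad_id n (u : 'M[A]_n) : pad n u = u.
Proof. by apply/matrixP => i j; rewrite mxE !valK. Qed.

Lemma pad_pad n N M (u : 'M[A]_n) : (n <= N)%N -> pad M (pad N u) = pad M u.
Proof.
move=> nN; apply/matrixP => i j; rewrite !mxE.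
have out (k : 'I_M) : (N <= k)%N -> insub (k : nat) = None :> option 'I_n.
  by move=> Nk; rewrite insubF// ltnNge (leq_trans nN Nk).
case: (@insubP _ _ 'I_N i) => [i' _ ii'|]; last first.
  by rewrite -leqNgt => /out->.
case: (@insubP _ _ 'I_N j) => [j' _ jj'|]; last first.
  by rewrite -leqNgt => /out->; case: insub.
have -> : (i == j) = (i' == j') by rewrite -!val_eqE/= ii' jj'.
by rewrite mxE ii' jj'.
Qed.

Lemma pad_unitary n N (u : 'M[A]_n) : (n <= N)%N -> unitary u -> unitary (pad N u).
Proof.
move=> /subnKC; move: (N - n)%N => k e [u'u uu']; rewrite -(castmx_stab e).
case: N / e; rewrite castmx_id /unitary /stab.
have -> : starmx (block_mx u 0 0 1%:M) = block_mx (starmx u) 0 0 1%:M :> 'M[A]_(n + k).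
  rewrite /starmx tr_block_mx map_block_mx !trmx0 -/(starmx u) -/(starmx 1%:M) starmx1.
  by congr block_mx; apply/matrixP => i j; rewrite !mxE star0.
rewrite !mulmx_block !(mul0mx, mulmx0, mul1mx, addr0, add0r) u'u uu'.
by rewrite -scalar_mx_block.
Qed.

Lemma pad_homotopic n N (u v : 'M[A]_n) : (n <= N)%N ->
  unitary_homotopic u v -> unitary_homotopic (pad N u) (pad N v).
Proof.
move=> nN [h [/within_continuous_mxP hc hu h0 h1]].
exists (fun t => pad N (h t : 'M[A]_n)); split; rewrite ?h0 ?h1//.
- apply/within_continuous_mxP => i j; under eq_fun do rewrite mxE.
  case: insub => [i'|]; last exact: path_cst.
  by case: insub => [j'|]; [exact: hc | exact: path_cst].
- by move=> t t01; apply: pad_unitary => //; exact: hu.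
Qed.

(** One common size N replaces the two stabilizations and the equation between their sizes;
    transitivity then only has to pass to a larger N. *)
Lemma stably_homotopicP (u v : unitaries A) : stably_homotopic u v <->
  exists N, [/\ (usize u < N)%N, (usize v < N)%N &
    unitary_homotopic (pad N (umx u)) (pad N (umx v))].
Proof.
split=> [[k [l [e uv]]]|[N [uN vN]]].
  exists ((usize v).+1 + l)%N; split; [by rewrite -e leq_addr | exact: leq_addr |].
  by rewrite -(castmx_stab e) -(castmx_stab erefl) castmx_id.
rewrite -(castmx_stab (subnKC uN)) -(castmx_stab (subnKC vN)).
move: (subnKC uN) (subnKC vN); move: (N - _)%N (N - _)%N => k l eu ev.
case: N / ev eu {uN vN} => eu; rewrite castmx_id => uv.
by exists l, k, eu.
Qed.

Lemma stably_homotopic_sym (u v : unitaries A) :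
  stably_homotopic u v -> stably_homotopic v u.
Proof.
move=> /stably_homotopicP[N [uN vN uv]]; apply/stably_homotopicP.
by exists N; split => //; exact: unitary_homotopic_sym.
Qed.

Lemma stably_homotopic_trans (v u w : unitaries A) :
  stably_homotopic u v -> stably_homotopic v w -> stably_homotopic u w.
Proof.
move=> /stably_homotopicP[N [uN vN uv]] /stably_homotopicP[M [vM wM vw]].
apply/stably_homotopicP; exists (maxn N M).
have NL := leq_maxl N M; have ML := leq_maxr N M.
split; [exact: leq_trans NL | exact: leq_trans ML |].
have := pad_homotopic NL uv; have := pad_homotopic ML vw.
by rewrite !pad_pad// => vw' uv'; exact: unitary_homotopic_trans vw'.
Qed.

(** Elements of [K1] are subsets bundled with a proof, so by proof irrelevance it is enough to
    equate the subsets, which symmetry and transitivity do. *)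
Lemma eq_K1_class (u v : unitaries A) :
  stably_homotopic u v -> K1_class u = K1_class v.
Proof.
move=> uv; apply: eq_exist; apply/seteqP; split => z /= hz.
  exact: stably_homotopic_trans (stably_homotopic_sym uv) hz.
exact: stably_homotopic_trans uv hz.
Qed.

End Stabilization.

Theorem lemma5p1 (R : realType) (q : R) (hq : 0 < q < 1)
    (A : cstarAlgType R) (alpha gamma : A) (hA : is_CSUq2 q alpha gamma) :
  alpha * alpha^#* \is a GRing.unit /\
  exists (hU : unitary (Umx q alpha gamma))
         (hw : unitary ((wtilde alpha gamma)%:M : 'M[A]_1)),
    K1_class (Unitaries hU) = K1_class (Unitaries hw).
Proof.
have rel := CSUq2_rel hA; split; first exact: aa'_unit rel.
exists (Umx_unitary rel), (wtilde_unitary hq rel).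
(* Size 2 suffices: U already fills it, and w is stabilized once to diag(w, 1). *)
apply/eq_K1_class/stably_homotopicP; exists 2; split => //=.
rewrite pad_id -(castmx_stab (erefl (1 + 1)%N)) castmx_id.
rewrite stab_mx2; exact: SUq2_homotopic.
Qed.
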